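(* Let $m\ge 2$ be an integer, let $\mu$ be a measure, let $1\le p\le\infty$, and let $\widehat{L}: L_{p}(\mu)\to\mathbb{C}$ be a continuous $m$-homogeneous polynomial on the complex space $L_p(\mu)$. Let $m'$ and $p'$ be the conjugate exponents of $m$ and $p$ respectively. Then for every integer $k$ with $1\le k\le m$ and every $x\in L_p(\mu)$ with $\|x\|_p<1$, \[ \|\widehat{D}^{k}\widehat{L}(x)\|\le \begin{cases} \dfrac{k!}{(1-\|x\|_p^{p})^{k/p}}\,\|\widehat{L}\| & \text{if } 1\le p\le m',\\[2mm] \dfrac{k!}{(1-\|x\|_p^{m'})^{k/m'}}\,\|\widehat{L}\| & \text{if } m'\le p\le m,\\[2mm] \dfrac{k!}{(1-\|x\|_p^{p'})^{k/p'}}\,\|\widehat{L}\| & \text{if } m\le p\le\infty. \end{cases} \]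
   Context: Conjugate exponents: $q'=q/(q-1)$ for $1<q<\infty$, $1'=\infty$, $\infty'=1$. For a Banach space $X$ over $\mathbb{K}$ ($\mathbb{R}$ or $\mathbb{C}$), a continuous $m$-homogeneous polynomial on $X$ is a map $\widehat{L}:X\to\mathbb{K}$ of the form $\widehat{L}(x)=L(x,\dots,x)$, where $L:X^m\to\mathbb{K}$ is a continuous symmetric $m$-linear form ($L$ is uniquely determined by $\widehat{L}$). Its norm is $\|\widehat{L}\|=\sup\{|\widehat{L}(x)|:\|x\|\le 1\}$. $D^k\widehat{L}(x)$ is the $k$th Fréchet derivative of $\widehat{L}$ at $x$, a continuous symmetric $k$-linear form on $X$, and $\widehat{D}^k\widehat{L}(x)$ is the associated $k$-homogeneous polynomial $y\mapsto D^k\widehat{L}(x)(y,\dots,y)$; explicitly $\widehat{D}^k\widehat{L}(x)y=k!\binom{m}{k}L(\underbrace{x,\dots,x}_{m-k},\underbrace{y,\dots,y}_{k})$. Its norm is $\|\widehat{D}^k\widehat{L}(x)\|=\sup_{\|y\|\le 1}|\widehat{D}^k\widehat{L}(x)y|$. *)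

(* Defs.v *)
From HB Require Import structures.
From mathcomp Require Import all_boot all_order all_algebra perm.
From mathcomp Require Import generic_quotient ring_quotient complex.
From mathcomp Require Import all_classical all_reals all_analysis.
From mathcomp Require Import measurable_realfun ess_sup_inf.

Set Implicit Arguments.
Unset Strict Implicit.
Unset Printing Implicit Defensive.

Import Order.TTheory GRing.Theory Num.Theory.
Import numFieldNormedType.Exports.

Local Open Scope classical_set_scope.
Local Open Scope ring_scope.

Section rnorm.
Context {R : realType} {V : normedZmodType R[i]}.

(* The norm of a space over R[i] takes its values in R[i], where they are real
   and nonnegative; rnorm is the same norm with values in R. *)
Definition rnorm (v : V) : R := complex.Re `|v|.

Lemma rnormE v : `|v| = (rnorm v)%:C%C.
Proof. by rewrite /rnorm RRe_real ?normr_real. Qed.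

Lemma rnorm_ge0 v : 0 <= rnorm v.
Proof. by rewrite -lecR -rnormE normr_ge0. Qed.

Lemma rnormD v w : rnorm (v + w) <= rnorm v + rnorm w.
Proof. by rewrite -lecR rmorphD/= -!rnormE ler_normD. Qed.

Lemma rnorm_eq0 v : rnorm v = 0 -> v = 0.
Proof. by move=> v0; apply/eqP; rewrite -normr_eq0 rnormE v0. Qed.

Lemma rnorm0 : rnorm 0 = 0.
Proof. by rewrite /rnorm normr0. Qed.

End rnorm.

Lemma rnormZ {R : realType} {V : normedModType R[i]} (a : R[i]) (v : V) :
  rnorm (a *: v) = rnorm (a : R[i]^o) * rnorm v.
Proof. by apply: complexI; rewrite rmorphM/= -!rnormE normrZ. Qed.

Section le_Lnorm.
Context d (T : measurableType d) (R : realType).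
Variable mu : {measure set T -> \bar R}.

Lemma le_Lnorm_ae (p : \bar R) (f g : T -> R) : (1 <= p)%E ->
  measurable_fun [set: T] f -> measurable_fun [set: T] g ->
  (forall t, 0 <= f t) -> (forall t, 0 <= g t) ->
  {ae mu, forall t, f t <= g t} ->
  ('N[mu]_p[EFin \o f] <= 'N[mu]_p[EFin \o g])%E.
Proof.
move=> p1 mf mg f0 g0 fg; rewrite unlock /Lnorm; case: p p1 => [r r1|_|//].
- have r0 : 0 <= r by rewrite (le_trans ler01).
  apply: gt0_ler_poweR; rewrite ?invr_ge0//.
  + by rewrite in_itv/= leey integral_ge0// => x _; exact: poweR_ge0.
  + by rewrite in_itv/= leey integral_ge0// => x _; exact: poweR_ge0.
  + have mpow (h : T -> R) : measurable_fun [set: T] h ->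
      measurable_fun [set: T] (fun x => (`|(EFin \o h) x| `^ r)%E).
      move=> mh; apply/measurable_EFinP.
      apply: (@measurableT_comp _ _ _ _ _ _ (@powR R ^~ r)) => //.
      exact: measurableT_comp.
    apply: ae_ge0_le_integral => //; [by move=> *; exact: poweR_ge0|exact: mpow|
      by move=> *; exact: poweR_ge0|exact: mpow|].
    apply: filterS fg => t fgt _ /=.
    by rewrite lee_fin !ger0_norm// ge0_ler_powR// nnegrE.
- case: ifPn => // _; apply: le_ess_sup.
  by apply: filterS fg => t fgt /=; rewrite !ger0_norm.
Qed.

End le_Lnorm.

Section Lp_function.
Context {d : measure_display} {T : measurableType d} {R : realType}.

(* Borel measurability of a complex function: R[i] carries no sigma-algebra in
   the libraries. *)
Definition cmeasurable (f : T -> R[i]^o) : Prop :=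
  measurable_fun [set: T] (fun t => complex.Re (f t)) /\
  measurable_fun [set: T] (fun t => complex.Im (f t)).

Lemma cmeasurable_rnorm f : cmeasurable f ->
  measurable_fun [set: T] (fun t => rnorm (f t)).
Proof.
move=> [mr mi].
rewrite (_ : (fun t => _) =
  (fun t => (complex.Re (f t) ^+ 2 + complex.Im (f t) ^+ 2) `^ 2^-1)); last first.
  apply/funext => t; rewrite powR12_sqrt ?addr_ge0 ?sqr_ge0//.
  by rewrite /rnorm [`|f t|]normc_def.
apply: (@measurableT_comp _ _ _ _ _ _ (@powR R ^~ 2^-1)) => //.
by apply: measurable_funD; apply: measurable_funX.
Qed.

Lemma cmeasurable0 : cmeasurable 0.
Proof. by split; exact: (measurable_cst (0 : R)). Qed.

Lemma cmeasurable_comb a f g : cmeasurable f -> cmeasurable g ->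
  cmeasurable (a *: f + g).
Proof.
move=> [fr fi] [gr gi]; split.
- rewrite (_ : (fun t => _) = (fun t =>
    (complex.Re a * complex.Re (f t) - complex.Im a * complex.Im (f t)) +
    complex.Re (g t))); last first.
    apply/funext => t /=; rewrite -[(a *: f + g) t]/(a * f t + g t).
    by case: a (f t) (g t) => [? ?] [? ?] [? ?].
  by apply: measurable_funD => //; apply: measurable_funB; apply: measurable_funM.
- rewrite (_ : (fun t => _) = (fun t =>
    (complex.Re a * complex.Im (f t) + complex.Im a * complex.Re (f t)) +
    complex.Im (g t))); last first.
    apply/funext => t /=; rewrite -[(a *: f + g) t]/(a * f t + g t).
    by case: a (f t) (g t) => [? ?] [? ?] [? ?].
  by apply: measurable_funD => //; apply: measurable_funD; apply: measurable_funM.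
Qed.


Variables (mu : {measure set T -> \bar R}) (p : \bar R) (p1 : (1 <= p)%E).

Definition cLnorm (f : T -> R[i]^o) : \bar R :=
  ('N[mu]_p[EFin \o (fun t => rnorm (f t))])%E.

(* The proof of 1 <= p is an argument so that the algebraic structures, which
   need it, can be inferred. *)
Definition cLfun (_ : (1 <= p)%E) : {pred T -> R[i]^o} :=
  mem [set f | cmeasurable f /\ (cLnorm f < +oo)%E].

Lemma cLfunP f : reflect (cmeasurable f /\ (cLnorm f < +oo)%E) (f \in cLfun p1).
Proof. by apply: (iffP idP) => [/set_mem|/mem_set]. Qed.

Lemma cLnormD f g : cmeasurable f -> cmeasurable g ->
  (cLnorm (f + g)%R <= cLnorm f + cLnorm g)%E.
Proof.
move=> mf mg.
have mfg : cmeasurable (f + g) by rewrite -[f]scale1r; exact: cmeasurable_comb.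
have ? := cmeasurable_rnorm mf; have ? := cmeasurable_rnorm mg.
apply: le_trans (eminkowski mu _ _ p1) => //.
apply: le_Lnorm_ae => //.
- exact: cmeasurable_rnorm.
- exact: measurable_funD.
- by move=> t; exact: rnorm_ge0.
- by move=> t /=; rewrite addr_ge0// rnorm_ge0.
- by apply/nearW => t; exact: rnormD.
Qed.

Lemma cLfun_rnorm f : f \in cLfun p1 -> (fun t => rnorm (f t)) \in Lfun mu p.
Proof.
move=> /cLfunP[mf fy]; rewrite inE; apply/andP; split; last by rewrite inE.
by apply: mem_set; exact: cmeasurable_rnorm.
Qed.

Lemma cLnormZ a f : f \in cLfun p1 ->
  (cLnorm (a *: f)%R = (rnorm (a : R[i]^o))%:E * cLnorm f)%E.
Proof.
move=> /cLfun_rnorm fL; rewrite -[(rnorm _)%:E]gee0_abs ?lee_fin ?rnorm_ge0//.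
rewrite -[RHS](@LnormZ _ _ _ _ _ p1 (Lfun_Sub p1 fL)); congr Lnorm.
by apply/funext => t /=; congr EFin; exact: rnormZ.
Qed.

Lemma cLnorm_cst0 : cLnorm 0 = 0%E.
Proof.
rewrite /cLnorm (_ : _ \o _ = cst 0%E) ?Lnorm0// ?gt_eqF ?(lt_le_trans _ p1)//.
by apply/funext => t /=; rewrite rnorm0.
Qed.

Lemma cLfun_submod_closed : submod_closed (cLfun p1).
Proof.
split.
  by apply/cLfunP; rewrite cLnorm_cst0; split => //; exact: cmeasurable0.
move=> a f g fL gL; apply/cLfunP.
have [mf fy] := cLfunP _ fL; have [mg gy] := cLfunP _ gL.
have maf : cmeasurable (a *: f).
  by rewrite -[a *: f]addr0; apply: cmeasurable_comb => //; exact: cmeasurable0.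
split; first exact: cmeasurable_comb.
apply: le_lt_trans (cLnormD maf mg) _; rewrite lte_add_pinfty//.
by rewrite (cLnormZ _ fL) lte_mul_pinfty// lee_fin rnorm_ge0.
Qed.

HB.instance Definition _ := GRing.isSubmodClosed.Build _ _ (cLfun p1)
  cLfun_submod_closed.

Definition cLfunType := {f : T -> R[i]^o | f \in cLfun p1}.
HB.instance Definition _ := SubChoice.on cLfunType.
HB.instance Definition _ := [SubChoice_isSubLmodule of cLfunType by <:].

Definition ae_null : {pred cLfunType} :=
  mem [set f | {ae mu, forall t, val f t = 0}].

Lemma ae_null_submod_closed : submod_closed ae_null.
Proof.
split; first by apply/mem_set/nearW => t.
move=> a f g /set_mem f0 /set_mem g0; apply/mem_set => /=.
apply: filterS2 f0 g0 => t ft gt.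
by rewrite -[LHS]/(a * val f t + val g t) ft gt mulr0 addr0.
Qed.

HB.instance Definition _ := GRing.isSubmodClosed.Build _ _ ae_null
  ae_null_submod_closed.


(* The complex space L_p(mu): p-integrable (essentially bounded if p = +oo)
   functions modulo almost everywhere equality. It is made a normedModType over
   R[i] below; its norm is computed by Lp_norm_pi. *)
Definition Lp := Quotient.quot (ae_null : zmodClosed cLfunType).
HB.instance Definition _ := GRing.Zmodule.on Lp.
HB.instance Definition _ := Choice.on Lp.
HB.instance Definition _ := EqQuotient.on Lp.

Local Open Scope quotient_scope.

Lemma Lp_eqP (f g : cLfunType) :
  reflect {ae mu, forall t, val f t = val g t} (f == g %[mod Lp]).
Proof.
rewrite -Quotient.idealrBE; apply: (iffP idP) => [/set_mem|] fg.
  by apply: filterS fg => t /eqP; rewrite subr_eq0 => /eqP.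
by apply/mem_set; apply: filterS fg => t fgt; apply/eqP; rewrite subr_eq0 fgt.
Qed.

Definition Lp_scale (a : R[i]) (x : Lp) : Lp := \pi_Lp (a *: repr x).

Lemma pi_scale a f : Lp_scale a (\pi_Lp f) = \pi_Lp (a *: f).
Proof.
apply/eqP/Lp_eqP.
have /eqP/Lp_eqP := reprK (\pi_Lp f).
by apply: filterS => t ft; rewrite -[LHS]/(a * val _ t) ft.
Qed.

Lemma pi_add f g : \pi_Lp (f + g) = \pi_Lp f + \pi_Lp g :> Lp.
Proof. exact: Quotient.pi_add. Qed.

Let LpE (P : Lp -> Prop) : (forall f, P (\pi_Lp f)) -> forall x, P x.
Proof. by move=> Pf x; rewrite -[x]reprK. Qed.

Let scalerA' a b x : Lp_scale a (Lp_scale b x) = Lp_scale (a * b) x.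
Proof. by elim/LpE: x => f; rewrite !pi_scale scalerA. Qed.

Let scale1r' x : Lp_scale 1 x = x.
Proof. by elim/LpE: x => f; rewrite !pi_scale scale1r. Qed.

Let scalerDr' a : {morph Lp_scale a : x y / x + y}.
Proof.
by elim/LpE => f; elim/LpE => g; rewrite -pi_add !pi_scale scalerDr pi_add.
Qed.

Let scalerDl' x : {morph Lp_scale^~ x : a b / a + b}.
Proof. by elim/LpE: x => f a b; rewrite !pi_scale scalerDl pi_add. Qed.

HB.instance Definition _ := GRing.Zmodule_isLmodule.Build R[i] Lp
  scalerA' scale1r' scalerDr' scalerDl'.

Definition Lp_norm (x : Lp) : R[i] := (fine (cLnorm (val (repr x))))%:C%C.

Let cLnorm_fin (f : cLfunType) : (fine (cLnorm (val f)))%:E = cLnorm (val f).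
Proof.
have [_ fy] := cLfunP _ (valP f).
by rewrite fineK// ge0_fin_numE//; exact: Lnorm_ge0.
Qed.

Lemma Lp_norm_pi f : Lp_norm (\pi_Lp f) = (fine (cLnorm (val f)))%:C%C.
Proof.
have /eqP/Lp_eqP h := reprK (\pi_Lp f).
have [m1 _] := cLfunP _ (valP f).
have [m2 _] := cLfunP _ (valP (repr (\pi_Lp f))).
have ? := cmeasurable_rnorm m1; have ? := cmeasurable_rnorm m2.
rewrite /Lp_norm; congr ((fine _)%:C%C); apply/eqP; rewrite eq_le.
by apply/andP; split; apply: le_Lnorm_ae => //;
  try (by move=> t; exact: rnorm_ge0); apply: filterS h => t ->.
Qed.

Let normD x y : Lp_norm (x + y) <= Lp_norm x + Lp_norm y.
Proof.
elim/LpE: x => f; elim/LpE: y => g; rewrite -pi_add !Lp_norm_pi -rmorphD lecR.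
rewrite -lee_fin EFinD !cLnorm_fin.
have [mf _] := cLfunP _ (valP f); have [mg _] := cLfunP _ (valP g).
exact: cLnormD.
Qed.

Let normZ a x : Lp_norm (a *: x) = `|a| * Lp_norm x.
Proof.
elim/LpE: x => f; rewrite [_ *: _]pi_scale !Lp_norm_pi.
rewrite [`|a|](@rnormE R R[i]^o a) -rmorphM; congr (_%:C%C).
by apply: EFin_inj; rewrite EFinM !cLnorm_fin (cLnormZ _ (valP f)).
Qed.

Let norm_eq0 x : Lp_norm x = 0 -> x = 0.
Proof.
elim/LpE: x => f; rewrite Lp_norm_pi => /complexI f0.
have {}f0 : cLnorm (val f) = 0%E by rewrite -cLnorm_fin f0.
rewrite -[RHS](_ : \pi_Lp 0 = 0); last first.
  by apply: (addIr (\pi_Lp 0)); rewrite -pi_add addr0 add0r.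
apply/eqP/Lp_eqP.
have [mf _] := cLfunP _ (valP f).
have /measurable_EFinP mn := cmeasurable_rnorm mf.
have h := Lnorm_eq0_eq0 mn (lt_le_trans lte01 p1) f0.
by apply: filterS h => t /(_ I) [] /rnorm_eq0.
Qed.

HB.instance Definition _ := Lmodule_isNormed.Build R[i] Lp normD normZ norm_eq0.

End Lp_function.

Section polynomials.
Context {K : numFieldType} {X : normedModType K}.

Definition multilinear (k : nat) (L : ('I_k -> X) -> K) : Prop :=
  forall (i : 'I_k) (v : 'I_k -> X),
    linear (fun z : X => L (@dfwith _ (fun=> X) v i z) : K^o).

(* {ptws 'I_k -> X} is X^k with its product topology. *)
Definition continuous_form (k : nat) (L : ('I_k -> X) -> K) : Prop :=
  multilinear L /\ continuous (L : {ptws 'I_k -> X} -> K^o).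

Definition symmetric_form (k : nat) (L : ('I_k -> X) -> K) : Prop :=
  forall (s : 'S_k) (v : 'I_k -> X), L (v \o s) = L v.

Definition diagonal (k : nat) (L : ('I_k -> X) -> K) : X -> K :=
  fun y => L (fun=> y).

Definition continuous_homogeneous_polynomial (m : nat) (P : X -> K) : Prop :=
  exists L : ('I_m -> X) -> K,
    [/\ continuous_form L, symmetric_form L & P = diagonal L].

Definition cons_vec (k : nat) (h : X) (v : 'I_k -> X) : 'I_k.+1 -> X :=
  fun i => oapp v h (unlift ord0 i).

(* F is a map from X to the space of continuous k-linear forms with the operator
   norm. Its Frechet derivative at x, a bounded linear map from X to that space,
   is identified with the continuous (k+1)-linear form A whose first argument is
   the direction of derivation. The bound for all v in the unit ball of X^k
   is the bound of the operator norm of F (x + h) - F x - A (h, ...). *)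
Definition is_frechet_derivative (k : nat) (F : X -> ('I_k -> X) -> K) (x : X)
    (A : ('I_k.+1 -> X) -> K) : Prop :=
  continuous_form A /\
  forall e : K, 0 < e -> \forall h \near (0 : X),
    forall v : 'I_k -> X, (forall i, `|v i| <= 1) ->
      `|F (x + h) v - F x v - A (cons_vec h v)| <= e * `|h|.

(* k-th Frechet derivative of f; the form selected by get is the unique
   derivative when there is one. *)
Fixpoint frechet_derivative (f : X -> K) (k : nat) : X -> ('I_k -> X) -> K :=
  if k is j.+1 then
    fun x => get (is_frechet_derivative (@frechet_derivative f j) x)
  else fun x _ => f x.

Definition hat_derivative (f : X -> K) (k : nat) (x : X) : X -> K :=
  diagonal (@frechet_derivative f k x).

End polynomials.

Arguments frechet_derivative {K X} f k.
Arguments hat_derivative {K X} f k.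

(* The supremum is taken in \bar R, so that it is +oo, not a default value, when
   P is unbounded on the unit ball. *)
Definition poly_norm {R : realType} {X : normedModType R[i]} (P : X -> R[i]) :
    \bar R :=
  ereal_sup [set (rnorm (P y))%:E | y in [set y : X | rnorm y <= 1]].

(* Main.v *)
(* The k-th Taylor coefficient of P at x in the direction y is the mean of
   P (x + z y) / z ^ k over roots of unity z, hence it is at most ||P|| times the
   mean of ||x + z y|| ^ m. Grouping z with - z, it is enough that
   ||u + v|| ^ m + ||u - v|| ^ m <= 2 as soon as ||u|| ^ s + ||v|| ^ s <= 1; the
   bound follows by rescaling y by (1 - ||x|| ^ s) ^ (1 / s).
   For s = 1 this is the triangle inequality. Otherwise let q be the conjugate
   exponent of s. When s <= p <= q and m <= q, Clarkson's inequality
     |a + b| ^ q + |a - b| ^ q <= 2 (|a| ^ s + |b| ^ s) ^ (q - 1)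
   for complex numbers passes to L_p by two applications of Minkowski's
   inequality, one for l_(q / p) and one for L_(p / s), and q can be lowered to m.
   The three cases of the theorem are (s, q) = (p, p'), (m', m) and (p', p). *)

Require Import Defs.
From HB Require Import structures.
From mathcomp Require Import all_boot all_order all_algebra perm.
From mathcomp Require Import complex ring lra zify.
From mathcomp Require Import all_classical all_reals all_analysis.
From mathcomp Require Import measurable_realfun.

Set Implicit Arguments.
Unset Strict Implicit.
Unset Printing Implicit Defensive.

Import Order.TTheory GRing.Theory Num.Theory.
Import numFieldNormedType.Exports.

Local Open Scope classical_set_scope.
Local Open Scope ring_scope.

(** * Clarkson's inequality *)

Section clarkson.
Context {R : realType}.
Implicit Types a b c r q s t x y z : R.

Lemma powR_convex r a b t : 1 <= r -> 0 <= a -> 0 <= b -> 0 <= t <= 1 ->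
  (t * a + (1 - t) * b) `^ r <= t * a `^ r + (1 - t) * b `^ r.
Proof.
move=> r1 a0 b0 /andP[t0 t1].
have := @convex_powR R r r1 (Itv01 t0 t1) a b.
by rewrite !inE/= !in_itv/= !andbT !convRE/= => /(_ a0 b0).
Qed.

(** [c + t] and [c - t] are convex combinations of [c + y] and [c - y] with swapped weights [l] and
    [1 - l], so by convexity of the power the symmetric sum grows with |t|. *)
Lemma powR_sum_sym_le r c t y : 1 <= r -> `|t| <= y <= c ->
  (c + t) `^ r + (c - t) `^ r <= (c + y) `^ r + (c - y) `^ r.
Proof.
move=> r1 /andP[ty yc].
have /andP[ty1 ty2] : - y <= t <= y by rewrite -ler_norml.
have [y0|y0] := leP y 0.
  have -> : t = 0 by lra.
  have -> : y = 0 by lra.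
  by [].
pose l := (y + t) / (2 * y).
have l01 : 0 <= l <= 1.
  by rewrite /l ler_pdivlMr ?ler_pdivrMr ?mul0r; lra.
have l01' : 0 <= 1 - l <= 1 by lra.
have cy0 : 0 <= c + y by lra.
have cy0' : 0 <= c - y by lra.
have H1 := powR_convex r1 cy0 cy0' l01.
have H2 := powR_convex r1 cy0 cy0' l01'.
have E1 : l * (c + y) + (1 - l) * (c - y) = c + t by rewrite /l; field; lra.
have E2 : (1 - l) * (c + y) + (1 - (1 - l)) * (c - y) = c - t.
  by rewrite /l; field; lra.
by rewrite E1 in H1; rewrite E2 in H2; lra.
Qed.

Lemma conjugate_expP q s : 1 < q -> s^-1 + q^-1 = 1 -> s = q / (q - 1).
Proof.
move=> q1 sq; have -> : s = (1 - q^-1)^-1 by rewrite -sq addrK invrK.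
by field; lra.
Qed.

Lemma conjugate_expE q : 1 < q -> (q / (q - 1))^-1 + q^-1 = 1.
Proof. by move=> q1; field; lra. Qed.

Lemma conjugate_exp_ge1 q s : 1 < q -> s^-1 + q^-1 = 1 -> 1 <= s.
Proof. by move=> q1 /(conjugate_expP q1) ->; rewrite ler_pdivlMr; lra. Qed.

Lemma conjugate_exp_le2 q : 2 <= q -> q / (q - 1) <= 2.
Proof. by move=> q2; rewrite ler_pdivrMr; lra. Qed.

(** Both inequalities say q r <= q + r. *)
Lemma le_conjugate_exp q r : 1 < q -> 1 < r -> r <= q / (q - 1) -> q <= r / (r - 1).
Proof. by move=> q1 r1; rewrite !ler_pdivlMr; lra. Qed.

(* Friedrichs' function: at [z = 1] it is the left-hand side of Clarkson's
   inequality for 1 and y, and at [z = y `^ (1 / (q - 1))] the right-hand side. *)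
Definition friedrichs q y z : R :=
  (1 + y * z `^ (1 - q)) * (1 + y * z) `^ (q - 1) +
  (1 - y * z `^ (1 - q)) * (1 - y * z) `^ (q - 1).

Lemma is_derive_friedrichs q y z : 0 < y < 1 -> 0 < z <= 1 ->
  is_derive z 1 (friedrichs q y)
    ((q - 1) * y * (1 - z `^ (- q)) *
     ((1 + y * z) `^ (q - 2) - (1 - y * z) `^ (q - 2))).
Proof.
move=> /andP[y0 y1] /andP[z0 z1].
have yz0 : 0 < y * z by rewrite mulr_gt0.
have yz1 : y * z < 1 by nra.
have dz := is_derive1_powR (1 - q) z0.
have pz : 0 < 1 + y * z by lra.
have nz : 0 < 1 - y * z by lra.
have dp : is_derive z 1 ((fun u : R => u `^ (q - 1)) \o (fun u : R => 1 + y * u))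
     (((q - 1) * (1 + y * z) `^ (q - 1 - 1)) * y).
  apply: is_derive1_comp; first exact: is_derive1_powR.
  by apply: is_derive_eq; rewrite /GRing.scale/=; ring.
have dn : is_derive z 1 ((fun u : R => u `^ (q - 1)) \o (fun u : R => 1 - y * u))
     (((q - 1) * (1 - y * z) `^ (q - 1 - 1)) * - y).
  apply: is_derive1_comp; first exact: is_derive1_powR.
  by apply: is_derive_eq; rewrite /GRing.scale/=; ring.
rewrite /comp in dp dn.
rewrite /friedrichs.
apply: is_derive_eq; rewrite /GRing.scale/=.
(* Once all powers are reduced to the exponents -q and q - 2, the terms in y z^(1 - q) cancel. *)
have E t u : 0 < t -> t `^ (u + 1) = t `^ u * t.
  by move=> t0; rewrite powRD ?(gt_eqF t0) ?implybT// powRr1// ltW.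
have -> : 1 - q - 1 = - q by ring.
have -> : q - 1 - 1 = q - 2 by ring.
have -> : q - 1 = (q - 2) + 1 by ring.
have -> : 1 - q = - q + 1 by ring.
by rewrite !E//; ring.
Qed.

(** The two sides are the values of [friedrichs q y] at 1 and at [z0], and this function is
    nonincreasing on [z0, 1]: in its derivative 1 - z^(-q) <= 0 since z <= 1, and the difference of
    powers is nonnegative since q >= 2. *)
Lemma clarkson1 q s y : 2 <= q -> s^-1 + q^-1 = 1 -> 0 < y < 1 ->
  (1 + y) `^ q + (1 - y) `^ q <= 2 * (1 + y `^ s) `^ (q - 1).
Proof.
move=> q2 sq y01; have /andP[y0 y1] := y01.
have q0 : 0 < q by lra.
have sE : s - 1 = (q - 1)^-1.
  by rewrite (conjugate_expP _ sq); [field|]; lra.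
have s1 : 0 < s - 1 by rewrite sE invr_gt0; lra.
pose z0 := y `^ (s - 1).
have z0_gt0 : 0 < z0 by exact: powR_gt0.
have z0_le1 : z0 <= 1.
  by rewrite -(powRr0 y); apply: ger_powR; [rewrite y0 ltW|exact: ltW].
have yz0 : y * z0 = y `^ s by rewrite mulr_powRB1// ?ltW//; lra.
have yz0' : y * z0 `^ (1 - q) = 1.
  rewrite -powRrM sE -[1 - q]opprB mulrN mulVf; last lra.
  by rewrite powR_inv1 ?ltW// mulfV// gt_eqF.
have F0 : friedrichs q y z0 = 2 * (1 + y `^ s) `^ (q - 1).
  by rewrite /friedrichs yz0' yz0 subrr mul0r addr0.
have F1 : friedrichs q y 1 = (1 + y) `^ q + (1 - y) `^ q.
  by rewrite /friedrichs powR1 mulr1 !mulr_powRB1//; lra.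
have D z : z0 <= z <= 1 -> is_derive z 1 (friedrichs q y)
    ((q - 1) * y * (1 - z `^ (- q)) *
     ((1 + y * z) `^ (q - 2) - (1 - y * z) `^ (q - 2))).
  by move=> /andP[? ?]; apply: is_derive_friedrichs => //; lra.
rewrite -F0 -F1; apply: (@ler0_derive1_le_cc _ (friedrichs q y) z0 1) => //.
- move=> z; rewrite in_itv/= => /andP[z0z z1].
  by have [] := D z ltac:(by rewrite !ltW).
- move=> z; rewrite in_itv/= => /andP[z0z z1].
  have zgt0 : 0 < z by apply: lt_trans z0z.
  have yz : 0 < y * z by rewrite mulr_gt0.
  have yz1 : y * z < 1 by nra.
  rewrite derive1E; have [_ ->] := D z ltac:(by rewrite !ltW).
  apply: mulr_le0_ge0.
    apply: mulr_ge0_le0; first nra.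
    rewrite subr_le0 -(powRr0 z); apply: ger_powR; last by lra.
    by rewrite zgt0 ltW.
  by rewrite subr_ge0; apply: ge0_ler_powR; rewrite ?nnegrE; lra.
- apply: derivable_within_continuous => z; rewrite in_itv/= => z01.
  by have [] := D z z01.
- by rewrite in_itv/= lexx z0_le1.
- by rewrite in_itv/= lexx z0_le1.
Qed.

(** Both sides are homogeneous of degree q, so division by a^q reduces the case 0 < b < a to
    [clarkson1] at b / a. For b = 0 and b = a there is equality. *)
Lemma clarkson_real q s a b : 2 <= q -> s^-1 + q^-1 = 1 -> 0 <= b <= a ->
  (a + b) `^ q + (a - b) `^ q <= 2 * (a `^ s + b `^ s) `^ (q - 1).
Proof.
move=> q2 sq /andP[b0 ba].
have sE : s = q / (q - 1) by apply: conjugate_expP => //; lra.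
have s0 : 0 < s by rewrite sE divr_gt0; lra.
have sqE : s * (q - 1) = q by rewrite sE mulfVK//; lra.
have [->|bn0] := eqVneq b 0.
  by rewrite addr0 subr0 (powR0 (lt0r_neq0 s0)) addr0 -powRrM sqE; lra.
have {bn0}b0 : 0 < b by rewrite lt_def bn0.
have a0 : 0 < a by exact: lt_le_trans ba.
have [<-|bna] := eqVneq b a.
  rewrite subrr powR0 ?addr0; last lra.
  have -> : b + b = 2 * b by ring.
  have -> : b `^ s + b `^ s = 2 * b `^ s by ring.
  rewrite !powRM ?powR_ge0//; try lra.
  by rewrite -powRrM sqE mulrA mulr_powRB1//; lra.
have {bna}ba : b < a by rewrite lt_def eq_sym bna.
have y01 : 0 < b / a < 1 by rewrite divr_gt0//= ltr_pdivrMr// mul1r.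
have := clarkson1 q2 sq y01.
have /andP[y0 y1] := y01.
have ay : a * (b / a) = b by rewrite mulrCA divff ?mulr1// gt_eqF.
have [a0' y0' y1'] : [/\ 0 <= a, 0 <= 1 + b / a & 0 <= 1 - b / a] by split; lra.
rewrite -(ler_pM2l (powR_gt0 q a0)) mulrDr -!powRM//.
rewrite [a `^ q * (2 * _)]mulrCA -{3}sqE (powRrM a s) -powRM ?powR_ge0//; last first.
  by rewrite addr_ge0// ?powR_ge0.
rewrite [a * (1 + _)]mulrDr [a * (1 - _)]mulrDr [a `^ s * _]mulrDr.
by rewrite -(powRM s a0' (ltW y0)) !mulr1 mulrN ay.
Qed.

Lemma rnorm_sqr (u : R[i]) :
  rnorm (u : R[i]^o) ^+ 2 = complex.Re u ^+ 2 + complex.Im u ^+ 2.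
Proof.
by rewrite /rnorm [`|u|]normc_def/= sqr_sqrtr// addr_ge0 ?sqr_ge0.
Qed.

(** For fixed moduli a and b, |u + v|^2 and |u - v|^2 are a^2 + b^2 plus and minus 2 Re (u conj v),
    where |Re (u conj v)| <= a b. By [powR_sum_sym_le] with exponent q / 2 >= 1 the worst case is
    that of aligned u and v, which is [clarkson_real]. *)
Lemma clarkson q s (u v : R[i]) : 2 <= q -> s^-1 + q^-1 = 1 ->
  rnorm (u + v : R[i]^o) `^ q + rnorm (u - v : R[i]^o) `^ q <=
  2 * (rnorm (u : R[i]^o) `^ s + rnorm (v : R[i]^o) `^ s) `^ (q - 1).
Proof.
move=> q2 sq.
wlog vu : u v / rnorm (v : R[i]^o) <= rnorm (u : R[i]^o).
  move=> H; have [vu|/ltW uv] := leP (rnorm (v : R[i]^o)) (rnorm (u : R[i]^o)).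
    exact: H.
  rewrite [X in 2 * X `^ _]addrC [u + v]addrC.
  have -> : rnorm (u - v : R[i]^o) = rnorm (v - u : R[i]^o).
    by rewrite /rnorm -normrN opprB.
  exact: H.
apply: le_trans (clarkson_real q2 sq _); last by rewrite rnorm_ge0.
have Ep (w : R) : 0 <= w -> w `^ q = (w ^+ 2) `^ (q / 2).
  by move=> w0; rewrite -powR_mulrn// -powRrM; congr (_ `^ _); lra.
have q21 : 1 <= q / 2 by lra.
rewrite !Ep ?subr_ge0 ?addr_ge0 ?rnorm_ge0//.
set a := rnorm u in vu *; set b := rnorm v in vu *.
have a0 : 0 <= a by exact: rnorm_ge0.
have b0 : 0 <= b by exact: rnorm_ge0.
have Ea : a ^+ 2 = complex.Re u ^+ 2 + complex.Im u ^+ 2 by exact: rnorm_sqr.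
have Eb : b ^+ 2 = complex.Re v ^+ 2 + complex.Im v ^+ 2 by exact: rnorm_sqr.
have -> : rnorm (u + v : R[i]^o) ^+ 2 =
    (complex.Re u + complex.Re v) ^+ 2 + (complex.Im u + complex.Im v) ^+ 2.
  by rewrite rnorm_sqr; case: (u) (v) => [? ?] [? ?].
have -> : rnorm (u - v : R[i]^o) ^+ 2 =
    (complex.Re u - complex.Re v) ^+ 2 + (complex.Im u - complex.Im v) ^+ 2.
  by rewrite rnorm_sqr; case: (u) (v) => [? ?] [? ?].
move: (complex.Re u) (complex.Im u) (complex.Re v) (complex.Im v) Ea Eb =>
  x y x' y' Ea Eb.
have -> : (x + x') ^+ 2 + (y + y') ^+ 2 = (a ^+ 2 + b ^+ 2) + 2 * (x * x' + y * y').
  by rewrite Ea Eb; ring.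
have -> : (x - x') ^+ 2 + (y - y') ^+ 2 = (a ^+ 2 + b ^+ 2) - 2 * (x * x' + y * y').
  by rewrite Ea Eb; ring.
have -> : (a + b) ^+ 2 = (a ^+ 2 + b ^+ 2) + 2 * (a * b) by ring.
have -> : (a - b) ^+ 2 = (a ^+ 2 + b ^+ 2) - 2 * (a * b) by ring.
apply: powR_sum_sym_le => //; apply/andP; split; last first.
  by have := sqr_ge0 (a - b); rewrite sqrrB; lra.
rewrite normrM ger0_norm// ler_pM2l//.
rewrite -[leRHS]ger0_norm ?mulr_ge0// -ler_sqr ?nnegrE// -!normrX.
rewrite !ger0_norm ?sqr_ge0// exprMn Ea Eb.
(* Cauchy-Schwarz in the plane, from Lagrange's identity. *)
have := sqr_ge0 (x * y' - y * x'); rewrite !expr2; lra.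
Qed.

(** Summing the tangent bound c^m <= 1 + (m / q) (c^q - 1) over a and b suffices; it is Young's
    inequality for c^m and 1 with exponents q / m and q / (q - m). *)
Lemma powR_sum_le2 q (m : nat) a b : (0 < m)%N -> m%:R <= q ->
  0 <= a -> 0 <= b -> a `^ q + b `^ q <= 2 -> a ^+ m + b ^+ m <= 2.
Proof.
move=> m0 mq a0 b0 ab.
have M0 : 0 < m%:R :> R by rewrite ltr0n.
have H c : 0 <= c -> c ^+ m <= 1 + m%:R / q * (c `^ q - 1).
  move=> c0; rewrite -powR_mulrn//; have [<-|mnq] := eqVneq m%:R q.
    by rewrite divff ?gt_eqF//; lra.
  have {}mq : m%:R < q by rewrite lt_def eq_sym mnq.
  have q0 : 0 < q by apply: lt_trans mq.
  have pq : (q / m%:R)^-1 + (q / (q - m%:R))^-1 = 1.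
    by field; rewrite !gt_eqF// subr_gt0.
  have := conjugate_powR (powR_ge0 c m%:R) ler01 _ _ pq.
  rewrite mulr1 powR1 -powRrM [m%:R * _]mulrCA divff ?gt_eqF// mulr1.
  move=> /(_ (divr_gt0 _ _)); rewrite q0 M0 divr_gt0 ?subr_gt0// => /(_ isT isT isT).
  suff -> : c `^ q / (q / m%:R) + 1 / (q / (q - m%:R)) =
    1 + m%:R / q * (c `^ q - 1) by [].
  by field; rewrite !gt_eqF// subr_gt0.
have k0 : 0 < m%:R / q by rewrite divr_gt0//; lra.
have := H _ a0; have := H _ b0; nra.
Qed.

End clarkson.

(** * Clarkson's inequality for integral norms *)

Section Lnorm_clarkson.
Context {R : realType}.

(* The norming functional of (a, b) in the two-dimensional l_r. *)
Lemma powR_sum_dual (r a b : R) : 1 <= r -> 0 <= a -> 0 <= b ->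
  exists u v, [/\ 0 <= u, 0 <= v, (a `^ r + b `^ r) `^ r^-1 <= u * a + v * b &
    forall c d, 0 <= c -> 0 <= d -> u * c + v * d <= (c `^ r + d `^ r) `^ r^-1].
Proof.
move=> r1 a0 b0; have r0 : 0 < r by rewrite (lt_le_trans _ r1).
have [rE|rn1] := eqVneq r 1.
  exists 1, 1; rewrite rE invr1; split=> // [|c d c0 d0].
    by rewrite !mul1r !powRr1// addr_ge0.
  by rewrite !mul1r !powRr1// addr_ge0.
have {rn1}r1 : 1 < r by rewrite lt_def rn1.
have [S0|Sn0] := eqVneq (a `^ r + b `^ r) 0.
  exists 0, 0; rewrite S0 powR0 ?invr_eq0 ?gt_eqF//; split=> // [|c d c0 d0].
    by rewrite !mul0r addr0.
  by rewrite !mul0r addr0 powR_ge0.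
set S := a `^ r + b `^ r in Sn0 *.
have S0 : 0 < S by rewrite lt_def Sn0 addr_ge0 ?powR_ge0.
pose q := r / (r - 1).
have q0 : 0 < q by rewrite divr_gt0// subr_gt0.
have rq : r^-1 + q^-1 = 1 by rewrite /q; field; rewrite !gt_eqF// subr_gt0.
have rq1 : (r - 1) * q = r by rewrite /q mulrCA divff ?mulr1// subr_eq0 gt_eqF.
(* The equality case of Hölder's inequality: (w a)^q + (w b)^q = 1. *)
pose w c := (c `^ (r - 1)) / S `^ q^-1.
have w0 c : 0 <= w c by rewrite divr_ge0 ?powR_ge0.
have wq c : w c `^ q = c `^ r / S.
  rewrite /w powRM ?invr_ge0 ?powR_ge0// -powRrM rq1; congr (_ * _).
  by rewrite -powRN -powRrM mulNr mulVf ?gt_eqF// powR_inv1 ?ltW.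
have wM c : 0 <= c -> w c * c = c `^ r / S `^ q^-1.
  by move=> c0; rewrite /w mulrAC [_ * c]mulrC mulr_powRB1.
exists (w a), (w b); split=> // [|c d c0 d0].
  rewrite !wM// -mulrDl -/S -{2}[S](powRr1 (ltW S0)).
  rewrite -powRB ?Sn0 ?implybT//.
  by have -> : 1 - q^-1 = r^-1 by rewrite -rq addrK.
rewrite [w a * c]mulrC [w b * d]mulrC.
apply: le_trans (hoelder2 c0 d0 (w0 a) (w0 b) r0 q0 rq) _.
by rewrite !wq -mulrDl divff// powR1 mulr1.
Qed.

Context d (T : measurableType d) (mu : {measure set T -> \bar R}).

Lemma Lnorm_powR (r : R) (h : T -> R) : (forall t, 0 <= h t) ->
  ('N[mu]_(r%:E)[EFin \o h] = (\int[mu]_t (h t `^ r)%:E) `^ r^-1)%E.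
Proof.
move=> h0; rewrite unlock; congr (_ `^ _)%E.
by apply: eq_integral => t _; rewrite /= ger0_norm.
Qed.

Lemma integral_powR (r n : R) (h : T -> R) : r != 0 -> (forall t, 0 <= h t) ->
  ('N[mu]_(r%:E)[EFin \o h] = n%:E)%E ->
  (\int[mu]_t (h t `^ r)%:E = (n `^ r)%:E)%E.
Proof.
move=> r0 h0 hn; rewrite -poweR_EFin -hn poweR_Lnorm//.
by apply: eq_integral => t _; rewrite /= ger0_norm.
Qed.

Lemma measurable_powR (h : T -> R) (r : R) : measurable_fun [set: T] h ->
  measurable_fun [set: T] (fun t => h t `^ r).
Proof. by move=> mh; apply: (@measurableT_comp _ _ _ _ _ _ (@powR R ^~ r)). Qed.

(** With k = q / r, the left-hand side is the k-th power of the l_k norm of the integrals of f^r and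
    g^r. Its norming functional moves the l_k norm under the integral, where the pointwise
    hypothesis gives 2^(1/k) h^(r/s) with h = a^s + b^s. Minkowski's inequality in L_(r/s) bounds
    the norm of h. *)
Lemma Lnorm_clarkson (q s r : R) (f g a b : T -> R) (nf ng na nb : R) :
  2 <= q -> s^-1 + q^-1 = 1 -> s <= r <= q ->
  measurable_fun [set: T] f -> measurable_fun [set: T] g ->
  measurable_fun [set: T] a -> measurable_fun [set: T] b ->
  (forall t, 0 <= f t) -> (forall t, 0 <= g t) ->
  (forall t, 0 <= a t) -> (forall t, 0 <= b t) ->
  ('N[mu]_(r%:E)[EFin \o f] = nf%:E)%E -> ('N[mu]_(r%:E)[EFin \o g] = ng%:E)%E ->
  ('N[mu]_(r%:E)[EFin \o a] = na%:E)%E -> ('N[mu]_(r%:E)[EFin \o b] = nb%:E)%E ->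
  (forall t, f t `^ q + g t `^ q <= 2 * (a t `^ s + b t `^ s) `^ (q - 1)) ->
  nf `^ q + ng `^ q <= 2 * (na `^ s + nb `^ s) `^ (q - 1).
Proof.
move=> q2 sq /andP[sr rq] mf mg ma mb f0 g0 a0 b0 Nf Ng Na Nb fgab.
have q0 : 0 < q by lra.
have sE : s = q / (q - 1) by apply: conjugate_expP => //; lra.
have s1 : 1 <= s by apply: conjugate_exp_ge1 sq; lra.
have s0 : 0 < s by lra.
have r0 : 0 < r by lra.
have sqE : q / s = q - 1 by rewrite sE invf_div mulrCA divff ?mulr1// gt_eqF.
have nge0 h n : ('N[mu]_(r%:E)[EFin \o h] = n%:E)%E -> 0 <= n.
  by move=> hn; rewrite -lee_fin -hn Lnorm_ge0.
have [nf0 ng0 na0 nb0] : [/\ 0 <= nf, 0 <= ng, 0 <= na & 0 <= nb].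
  by split; [exact: nge0 Nf|exact: nge0 Ng|exact: nge0 Na|exact: nge0 Nb].
have rs1 : 1 <= r / s by rewrite ler_pdivlMr// mul1r.
have rn0 : r != 0 by rewrite gt_eqF.
have powN h n : (forall t, 0 <= h t) -> ('N[mu]_(r%:E)[EFin \o h] = n%:E)%E ->
    0 <= n ->
    ('N[mu]_((r / s)%:E)[EFin \o (fun t => (h t `^ s)%R)] = (n `^ s)%:E)%E.
  move=> h0 hn n0; rewrite Lnorm_powR => [|t]; last exact: powR_ge0.
  under eq_integral do rewrite -powRrM mulrCA divff ?gt_eqF// mulr1.
  rewrite (integral_powR rn0 h0 hn) poweR_EFin -powRrM invf_div mulrCA divff//.
  by rewrite mulr1.
have := minkowski_EFin mu (measurable_powR s ma) (measurable_powR s mb) rs1.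
rewrite (powN _ _ a0 Na na0) (powN _ _ b0 Nb nb0) -EFinD.
set h := (_ \+ _)%R => hle.
have hE : ('N[mu]_((r / s)%:E)[EFin \o h])%E \is a fin_num.
  by rewrite ge0_fin_numE ?Lnorm_ge0//; apply: le_lt_trans hle _; rewrite ltry.
move: hE hle => /fineK; set n := fine _ => /esym hn; rewrite hn lee_fin => nle.
have n0 : 0 <= n by rewrite -lee_fin -hn Lnorm_ge0.
have h0 t : 0 <= h t by rewrite addr_ge0// powR_ge0.
have ih : (\int[mu]_t (h t `^ (r / s))%:E = (n `^ (r / s))%:E)%E.
  by apply: integral_powR => //; rewrite gt_eqF// (lt_le_trans _ rs1).
pose k := q / r.
have k1 : 1 <= k by rewrite ler_pdivlMr// mul1r.
have k0 : 0 < k by lra.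
have [u [v [u0 v0 uvN uvle]]] := powR_sum_dual k1 (powR_ge0 nf r) (powR_ge0 ng r).
have rk : r * k = q by rewrite /k mulrCA divff ?mulr1.
rewrite -!powRrM rk in uvN.
have mfr := measurable_powR r mf; have mgr := measurable_powR r mg.
have mh : measurable_fun [set: T] h.
  by apply: measurable_funD; exact: measurable_powR.
have uvI : u * nf `^ r + v * ng `^ r <= 2 `^ k^-1 * n `^ (r / s).
  rewrite -lee_fin EFinD !EFinM -(integral_powR rn0 f0 Nf).
  rewrite -(integral_powR rn0 g0 Ng) -ih.
  have gr0 z : (0 <= (z `^ r)%:E)%E by rewrite lee_fin powR_ge0.
  rewrite -!ge0_integralZl_EFin ?powR_ge0//; last 4 first.
  - by move=> t _; rewrite lee_fin powR_ge0.
  - exact/measurable_EFinP/measurable_powR.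
  - exact/measurable_EFinP.
  - exact/measurable_EFinP.
  rewrite -ge0_integralD//; last 4 first.
  - by move=> t _; rewrite -EFinM lee_fin mulr_ge0 ?powR_ge0.
  - by apply/measurable_EFinP; apply: measurable_funM.
  - by move=> t _; rewrite -EFinM lee_fin mulr_ge0 ?powR_ge0.
  - by apply/measurable_EFinP; apply: measurable_funM.
  apply: ge0_le_integral => //.
  - by move=> t _; rewrite -!EFinM -EFinD lee_fin addr_ge0// mulr_ge0 ?powR_ge0.
  - by apply/measurable_EFinP; apply: measurable_funD; apply: measurable_funM.
  - apply/measurable_EFinP; apply: measurable_funM => //; exact: measurable_powR.
  move=> t _; rewrite -!EFinM -EFinD lee_fin.
  apply: le_trans (uvle _ _ (powR_ge0 _ _) (powR_ge0 _ _)) _.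
  rewrite -!powRrM rk.
  have ki : 0 <= k^-1 by rewrite invr_ge0 ltW.
  (* The exponents match because (q - 1) / k = (q / s) (r / q) = r / s. *)
  have -> : 2 `^ k^-1 * h t `^ (r / s) = (2 * h t `^ (q - 1)) `^ k^-1.
    rewrite powRM ?powR_ge0// -powRrM -sqE /k invf_div; congr (_ * _ `^ _).
    by rewrite mulrACA [q * _]mulrC mulrAC; field; rewrite !gt_eqF.
  apply: ge0_ler_powR; rewrite ?nnegrE ?addr_ge0 ?mulr_ge0 ?powR_ge0//.
have {}uvN := le_trans uvN uvI.
have := ge0_ler_powR (ltW k0) _ _ uvN.
rewrite !nnegrE powR_ge0 mulr_ge0 ?powR_ge0// => /(_ isT isT).
rewrite powRM ?powR_ge0// -!powRrM mulVf ?(gt_eqF k0)// !powRr1 ?addr_ge0 ?powR_ge0//.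
have -> : r / s * k = q - 1 by rewrite -sqE /k; field; rewrite !gt_eqF.
move=> /le_trans; apply; rewrite ler_pM2l//.
have q10 : 0 <= q - 1 by lra.
by apply: ge0_ler_powR => //; rewrite nnegrE ?addr_ge0 ?powR_ge0.
Qed.

End Lnorm_clarkson.

(** * Multilinear forms and Fréchet derivatives *)

Section product_topology.
Context {I : Type} {V : topologicalType}.

Lemma cvg_ptws (F : set_system (I -> V)) (f : I -> V) : Filter F ->
  (forall i, g i @[g --> F] --> f i) -> F --> (f : {ptws I -> V}).
Proof.
move=> FF Ff; apply/cvg_sup => i; rewrite cvg_image; last first.
  by rewrite eqEsubset; split=> v // _; exists (fun=> v).
apply: cvg_trans (Ff i) => W /=; rewrite nbhs_simpl => FW.
exists (@^~ i @^-1` W) => //.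
by rewrite image_preimage // eqEsubset; split=> // j _; exists (fun _ => j).
Qed.

Lemma continuous_ptws {J : topologicalType} (h : J -> {ptws I -> V}) :
  (forall i, continuous (fun x => h x i)) -> continuous h.
Proof. by move=> hc x; apply: cvg_ptws => i; apply: hc. Qed.

End product_topology.

Section multilinear.
Context {K : numFieldType} {X : normedModType K}.

Lemma eq_dfwith (J : eqType) (v w : J -> X) i z :
  w i = z -> (forall j, j != i -> w j = v j) -> @dfwith _ (fun=> X) v i z = w.
Proof.
move=> wi wv; apply/funext => j.
by case: dfwithP => // {}j ij; rewrite wv// eq_sym.
Qed.

Context {n : nat} (L : ('I_n -> X) -> K).

Lemma multilinear0 v i : multilinear L -> L (@dfwith _ (fun=> X) v i 0) = 0.
Proof.
move=> mL; have := mL i v (-1) 0 0.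
by rewrite scaler0 addr0 scaleN1r addrC subrr.
Qed.

Lemma multilinear_prod (c : 'I_n -> K) v : multilinear L ->
  L (fun i => c i *: v i) = (\prod_i c i) * L v.
Proof.
move=> mL.
(* The factors are pulled out one index at a time; [s] lists the indices already scaled. *)
suff H (s : seq 'I_n) : uniq s ->
    L (fun i => (if i \in s then c i else 1) *: v i) = (\prod_(i <- s) c i) * L v.
  rewrite -H ?index_enum_uniq//.
  by congr L; apply/funext => i; rewrite mem_index_enum.
elim: s => [_|i s ih /= /andP[sNi us]].
  by rewrite big_nil mul1r; congr L; apply/funext => i; rewrite scale1r.
pose w j := (if j \in s then c j else 1) *: v j.
have := mL i w (c i) (v i) 0; rewrite multilinear0// addr0 addr0.
rewrite (@eq_dfwith _ w (fun j => (if j \in i :: s then c j else 1) *: v j));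
  last 2 first.
- by rewrite mem_head.
- by move=> j ji; rewrite inE (negbTE ji).
rewrite (@eq_dfwith _ w w)//; last by rewrite /w (negbTE sNi) scale1r.
by move=> ->; rewrite ih// big_cons -mulrA.
Qed.

(** Since 0^-1 = 0, a zero argument is normalized to 0, and no argument has to be nonzero. *)
Lemma multilinear_normalize v : multilinear L ->
  L v = (\prod_i `|v i|) * L (fun i => `|v i|^-1 *: v i).
Proof.
move=> mL; rewrite -(multilinear_prod (fun i => `|v i|))//; congr L; apply/funext => i.
have [->|vi0] := eqVneq (v i) 0; first by rewrite !scaler0.
by rewrite scalerA divff ?scale1r// normr_eq0.
Qed.

Lemma normalize_le1 (y : X) : `| `|y|^-1 *: y| <= 1.
Proof.
have [->|y0] := eqVneq y 0; first by rewrite scaler0 normr0.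
by rewrite normrZ normfV normr_id mulVf// normr_eq0.
Qed.

Lemma continuous_form_bounded : continuous_form L ->
  exists2 C, 0 <= C & forall v, `|L v| <= C * \prod_i `|v i|.
Proof.
move=> [mL cL].
(* The sup-norm balls form a filter converging to 0 in the product topology, so continuity at 0
   yields a radius [d] common to all coordinates. *)
pose F : set_system ('I_n -> X) :=
  filter_from [set e : K | 0 < e] (fun e => [set v | forall i, `|v i| <= e]).
have FF : Filter F.
  apply: filter_from_filter; first by exists 1; exact: ltr01.
  move=> e1 e2 /= e10 e20.
  have cmp : (e1 >=< e2)%O by apply: real_comparable; exact: gtr0_real.
  exists (Num.min e1 e2) => [|v /= ve]; first by rewrite /= comparable_lt_min// e10.
  by split=> i; have := ve i; rewrite comparable_le_min// => /andP[].
have F0 : F --> ((fun=> 0) : {ptws 'I_n -> X}).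
  apply: cvg_ptws => i; apply/cvgr0Pnorm_le => e e0.
  by exists e => // v /= /(_ i).
have /cvgrPdist_le/(_ 1 ltr01) : L @ F --> (L (fun=> 0) : K^o).
  by move=> A /(cL (fun=> 0)); exact: F0.
(* The summand [|L (fun=> 0)|] accounts for n = 0, where the form is an arbitrary constant. *)
case=> d /= d0 Ld; exists ((1 + `|L (fun=> 0)|) * d^-1 ^+ n).
  by rewrite mulr_ge0 ?addr_ge0 ?exprn_ge0 ?invr_ge0// ltW.
move=> v; rewrite (multilinear_normalize v mL) normrM mulrC.
rewrite normr_prod; under eq_bigr do rewrite normr_id.
apply: ler_wpM2r; first exact: prodr_ge0.
set u := fun i => _; have u1 i : `|u i| <= 1 by exact: normalize_le1.
have -> : L u = d^-1 ^+ n * L (fun i => d *: u i).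
  rewrite (multilinear_prod (fun=> d))// prodr_const card_ord mulrA -exprMn.
  by rewrite mulVf ?gt_eqF// expr1n mul1r.
rewrite normrM ger0_norm ?exprn_ge0 ?invr_ge0 ?(ltW d0)// mulrC ler_pM2r; last first.
  by rewrite exprn_gt0 ?invr_gt0.
rewrite -[L _](subrK (L (fun=> 0))) (le_trans (ler_normD _ _))// lerD2r distrC.
by apply: Ld => i; rewrite normrZ gtr0_norm// -[leRHS]mulr1 ler_pM2l.
Qed.

End multilinear.

(** * Symmetric forms with lists of arguments *)

Section seq_form.
Context {K : numFieldType} {X : normedModType K}.

(** With lists, repeated arguments are [nseq] blocks and symmetry is invariance under [perm_eq]. *)
Definition seq_form m (L : ('I_m -> X) -> K) (s : seq X) : K :=
  L (fun i => nth 0 s i).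

Context {m : nat} (L : ('I_m -> X) -> K).
Context (sL : Defs.symmetric_form L) (mL : multilinear L).
Implicit Types (s t : seq X) (x y h : X).
Local Notation Ls := (seq_form L).

Lemma seq_form_perm s t : size s = m -> perm_eq s t -> Ls s = Ls t.
Proof.
move=> sm st; have tm : size t = m by rewrite -(perm_size st).
move: st; rewrite -[s]/(tval (Tuple (introT eqP sm))).
rewrite -[t]/(tval (Tuple (introT eqP tm))).
move=> /tuple_permP[p ps].
rewrite /seq_form -[RHS](sL p); congr L; apply/funext => i.
by rewrite ps /= (nth_map i) ?size_enum_ord// nth_ord_enum (tnth_nth 0).
Qed.

Lemma seq_form_linear a x y s : (0 < m)%N ->
  Ls ((a *: x + y) :: s) = a * Ls (x :: s) + Ls (y :: s).
Proof.
move=> m0; pose i0 := Ordinal m0.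
have E z : Ls (z :: s) =
    L (@dfwith _ (fun=> X) (fun i : 'I_m => nth 0 (0 :: s) i) i0 z).
  by rewrite (eq_dfwith (w := fun i : 'I_m => nth 0 (z :: s) i))// => -[[|j] jm].
by rewrite !E; exact: mL.
Qed.

Lemma seq_form_bounded C s : (forall v, `|L v| <= C * \prod_i `|v i|) ->
  size s = m -> `|Ls s| <= C * \prod_(y <- s) `|y|.
Proof. by move=> LC sm; rewrite (big_nth 0) sm big_mkord; exact: LC. Qed.

(** Induction on n: linearity splits one argument x + h, the resulting x or h joins the prefix [s],
    symmetry puts it in its block, and Pascal's rule collects the terms. *)
Lemma seq_form_binomial x h s n : (size s + n = m)%N ->
  Ls (s ++ nseq n (x + h)) =
  \sum_(j < n.+1) Ls (s ++ nseq j h ++ nseq (n - j) x) *+ 'C(n, j).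
Proof.
elim: n s => [|n ih] s sn; first by rewrite big_ord_recr big_ord0 /= add0r.
have Lcons y t : (size s + size t).+1 = m -> Ls (s ++ y :: t) = Ls ((y :: s) ++ t).
  move=> st; apply: seq_form_perm; first by rewrite size_cat/= addnS.
  by rewrite -cat1s perm_catCA.
rewrite /= Lcons ?size_nseq -?addnS//.
have m0 : (0 < m)%N by rewrite -sn addnS.
rewrite -[x in (x + h :: s)]scale1r -[RHS]/(_) cat_cons seq_form_linear// mul1r.
rewrite -!cat_cons !ih /= ?addSn -?addnS//.
pose T j := Ls (s ++ nseq j h ++ nseq (n.+1 - j) x).
rewrite (eq_bigr (fun j : 'I_n.+1 => T j *+ 'C(n, j))); last first.
  move=> [j jn] _ /=; congr (_ *+ _); rewrite /T subSn//.
  apply: seq_form_perm; first by rewrite /= !size_cat !size_nseq subnKC// -sn addnS.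
  rewrite -[x :: _]/([:: x] ++ (s ++ nseq j h ++ nseq (n - j) x)) !(catA s).
  by rewrite -[X in _ ++ _ :: X]cat0s -cat1s perm_catCA.
have -> : \sum_(j < n.+1) Ls (h :: s ++ nseq j h ++ nseq (n - j) x) *+ 'C(n, j) =
    \sum_(j < n.+1) T j.+1 *+ 'C(n, j).
  apply: eq_bigr => -[j jn] _ /=; congr (_ *+ _); rewrite /T subSS /= Lcons//.
  by rewrite size_cat !size_nseq subnKC// -addnS.
rewrite [RHS]big_ord_recl [X in X + _ = _]big_ord_recl -!addrA /=.
rewrite !bin0; congr (T 0%N *+ _ + _).
rewrite [RHS](eq_bigr
  (fun j : 'I_n.+1 => T j.+1 *+ 'C(n, j.+1) + T j.+1 *+ 'C(n, j))).
  rewrite big_split/=; congr (_ + _).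
  by rewrite [RHS]big_ord_recr/= bin_small// mulr0n addr0.
by move=> j _; rewrite /bump/= add1n binS mulrnDr.
Qed.

Lemma seq_form_scale (a : K) y j t : (j + size t = m)%N ->
  Ls (nseq j (a *: y) ++ t) = a ^+ j * Ls (nseq j y ++ t).
Proof.
move=> jm; rewrite /seq_form.
pose c (i : 'I_m) := if (i < j)%N then a else 1.
have jm' : (j <= m)%N by rewrite -jm leq_addr.
transitivity (L (fun i => c i *: nth 0 (nseq j y ++ t) i)).
  congr L; apply/funext => i; rewrite /c !nth_cat !size_nseq !nth_nseq.
  by case: ltnP; rewrite // scale1r.
rewrite multilinear_prod//; congr (_ * _); rewrite -big_mkcond/=.
by rewrite prodr_const -sum1_card (big_ord_narrow jm') sum1_card card_ord.
Qed.

End seq_form.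

(** * Derivatives of homogeneous polynomials *)

Section frechet.
Context {K : numFieldType} {X : normedModType K}.

Lemma cons_vec_lift k (w : 'I_k.+1 -> X) :
  w = cons_vec (w ord0) (fun i => w (lift ord0 i)).
Proof. by apply/funext => i; rewrite /cons_vec; case: unliftP => [j|] ->. Qed.

Lemma codom_cons_vec k h (v : 'I_k -> X) :
  [seq cons_vec h v i | i <- enum 'I_k.+1] = h :: [seq v i | i <- enum 'I_k].
Proof.
rewrite enum_ordSl/= -map_comp /cons_vec unlift_none/=; congr (_ :: _).
by apply: eq_map => i /=; rewrite liftK.
Qed.

(** If A and B differ by D > 0 at (h, v), the two estimates at a small multiple t h give t D <= 2 e
    t |h|; [e] is chosen so that 2 e |h| < D. *)
Lemma frechet_derivative_unique k (G : X -> ('I_k -> X) -> K) x A B :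
  is_frechet_derivative G x A -> is_frechet_derivative G x B -> A = B.
Proof.
move=> [[mA _] dA] [[mB _] dB].
suff H w : (forall i, `|w i| <= 1) -> A w = B w.
  apply/funext => w; rewrite (multilinear_normalize w mA) (multilinear_normalize w mB).
  by rewrite H// => i; exact: normalize_le1.
rewrite (cons_vec_lift w); set h := w ord0; set v := fun i => _ => w1.
have v1 i : `|v i| <= 1.
  by have := w1 (lift ord0 i); rewrite /cons_vec liftK.
apply/eqP; rewrite -subr_eq0 -normr_eq0; apply/negPn/negP => D0.
set D := `|_| in D0; have {}D0 : 0 < D by rewrite lt_def D0 normr_ge0.
have h1 : 0 < `|h| + 1 by rewrite ltr_wpDl.
pose e := D / (2 * (`|h| + 1)) / 2.
have e0 : 0 < e by rewrite /e !divr_gt0// mulr_gt0.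
have [d /= d0 Hd] := nbhs_norm0P.1 (filterI (dA e e0) (dB e e0)).
pose t := d / (2 * (`|h| + 1)).
have t0 : 0 < t by rewrite divr_gt0// mulr_gt0.
have th : `|t *: h| < d.
  rewrite normrZ gtr0_norm// /t mulrAC ltr_pdivrMr ?mulr_gt0// ltr_pM2l//.
  by rewrite mulrDr mulr1 (@le_lt_trans _ _ (2 * `|h|)) ?ltrDl// ler_peMl// ler1n.
clearbody t; have [HA HB] := Hd _ th.
have scal (M : ('I_k.+1 -> X) -> K) : multilinear M ->
    M (cons_vec (t *: h) v) = t * M (cons_vec h v).
  move=> mM; have := mM ord0 (cons_vec h v) t h 0; rewrite multilinear0// !addr0.
  rewrite (eq_dfwith (w := cons_vec (t *: h) v)); last 2 first.
  - by rewrite /cons_vec unlift_none.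
  - by move=> j; rewrite /cons_vec; case: unliftP => [i ->|->]; rewrite ?eqxx.
  rewrite (eq_dfwith (w := cons_vec h v))//.
  by rewrite /cons_vec unlift_none.
have := le_trans (ler_normB _ _) (lerD (HA v v1) (HB v v1)).
rewrite !scal//; set a := G _ _ - _.
have -> : a - t * A (cons_vec h v) - (a - t * B (cons_vec h v)) =
    t * (B (cons_vec h v) - A (cons_vec h v)) by ring.
rewrite normrM normrZ (gtr0_norm t0) distrC -/D -!mulrDr mulrCA ler_pM2l//.
rewrite lt_geF//; have -> : e * (`|h| + `|h|) = D * `|h| / (2 * (`|h| + 1)) * 2 / 2.
  by rewrite /e; field; rewrite gt_eqF.
rewrite mulfK// ltr_pdivrMr ?mulr_gt0// ltr_pM2l//.
by rewrite mulrDr mulr1 (@le_lt_trans _ _ (2 * `|h|)) ?ltrDl// ler_peMl// ler1n.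
Qed.

(** The k-th derivative at x of the polynomial of [L], for k <= m; the falling factorial is k! C(m,
    k). *)
Definition derivative_form m (L : ('I_m -> X) -> K) k x (v : 'I_k -> X) : K :=
  (m ^_ k)%:R * seq_form L ([seq v i | i <- enum 'I_k] ++ nseq (m - k) x).

Context {m : nat} (L : ('I_m -> X) -> K).
Context (sL : Defs.symmetric_form L) (cL : continuous_form L).

Lemma continuous_derivative_form k x : (k <= m)%N ->
  continuous_form (derivative_form L (k := k) x).
Proof.
have [mL contL] := cL; move=> km.
(* [ext] pads v with copies of x; being continuous and coordinatewise, it transfers multilinearity
   and continuity from [L]. *)
pose ext (v : 'I_k -> X) (i : 'I_m) :=
  nth 0 ([seq v i | i <- enum 'I_k] ++ nseq (m - k) x) i.
have extE v i : ext v i = if insub (val i) is Some j then v j else x.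
  rewrite /ext nth_cat size_map size_enum_ord; case: ltnP => ik.
    rewrite insubT (nth_map (Ordinal ik)) ?size_enum_ord//; congr v.
    by apply: val_inj; rewrite /= nth_enum_ord.
  by rewrite insubF ?ltnNge ?ik// nth_nseq ltn_sub2rE ?ltn_ord.
split.
  move=> i v a y z; rewrite /derivative_form /seq_form -!/(ext _).
  have E w : ext (@dfwith _ (fun=> X) v i w) =
      @dfwith _ (fun=> X) (ext v) (widen_ord km i) w.
    apply/esym/eq_dfwith => [|j ji]; rewrite !extE/=.
      rewrite insubT//= => ik; rewrite -[RHS](@dfwithin _ (fun=> X) v i).
      by congr dfwith; apply: val_inj.
    case: insubP => // j' _ jj'; rewrite dfwithout//.
    by apply: contraNneq ji => ->; apply/eqP/val_inj.
  by rewrite !E mL mulrDr mulrCA.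
move=> v.
have ce : continuous (ext : {ptws 'I_k -> X} -> {ptws 'I_m -> X}).
  apply: continuous_ptws => i.
  under [X in continuous X]eq_fun do rewrite extE.
  case: insubP => [j _ _|_]; last exact: cst_continuous.
  exact: proj_continuous.
apply: (@cvgM K {ptws 'I_k -> X} (nbhs v) _ (fun=> _) (L \o ext)).
  exact: cvg_cst.
by move=> A /(contL (ext v)); exact: ce.
Qed.

(** In the binomial expansion of the m - k arguments x + h, the terms of degree 0 and 1 in h are the
    value and the derivative; the others are O(|h|^2) uniformly for v in the unit ball. *)
Lemma is_frechet_derivative_form k x : (k < m)%N ->
  is_frechet_derivative (derivative_form L (k := k)) x
    (derivative_form L (k := k.+1) x).
Proof.
move=> km; split; first exact: continuous_derivative_form.
have [mL _] := cL.
have [C C0 LC] := continuous_form_bounded cL.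
have [n mkE] : exists n, (m - k = n.+1)%N.
  by exists (m - k).-1; rewrite prednK// subn_gt0.
move=> e e0.
(* Bounds the terms with j + 2 arguments h, using |h|^(j+2) <= |h|^2 for |h| <= 1. *)
pose D := (m ^_ k)%:R * \sum_(j < n) C * `|x| ^+ (n.+1 - j.+2) *+ 'C(n.+1, j.+2).
have D0 : 0 <= D.
  by rewrite mulr_ge0// sumr_ge0// => j _; rewrite mulrn_wge0// mulr_ge0.
near=> h => v v1.
have h1 : `|h| <= 1 by near: h; exact: nbhs0_le.
set s := [seq v i | i <- enum 'I_k].
have ss : size s = k by rewrite size_map size_enum_ord.
have s1 : \prod_(y <- s) `|y| <= 1.
  by rewrite big_map; apply: Num.Theory.prodr_ile1 => i _; rewrite normr_ge0 v1.
rewrite /derivative_form codom_cons_vec -/s mkE.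
have -> : (m - k.+1 = n)%N by rewrite subnS mkE.
rewrite (@seq_form_binomial _ _ _ _ sL mL) ?ss -?mkE ?subnKC 1?ltnW// mkE.
rewrite 2!big_ord_recl/= /bump/= !add1n bin0 bin1 subSS subn0.
set T := \sum_(_ < _) _; set T0 := seq_form _ _.
rewrite ffactnSr mkE natrM.
have -> : seq_form L (s ++ h :: nseq n x) = seq_form L ((h :: s) ++ nseq n x).
  apply: (seq_form_perm sL); last by rewrite -cat1s perm_catCA.
  by rewrite size_cat/= size_nseq ss -mkE subnKC// ltnW.
set T1 := seq_form _ _.
have -> : (m ^_ k)%:R * (T0 *+ 1 + (T1 *+ n.+1 + T)) - (m ^_ k)%:R * T0 -
    (m ^_ k)%:R * n.+1%:R * T1 = (m ^_ k)%:R * T.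
  by rewrite mulr1n -mulr_natr; ring.
have TD : `|(m ^_ k)%:R * T| <= D * `|h| ^+ 2.
  rewrite normrM ger0_norm// -mulrA ler_wpM2l// mulr_suml.
  apply: le_trans (ler_norm_sum _ _ _) _; apply: ler_sum => j _.
  rewrite add0n !add1n normrMn mulrnAl lerMn2r; apply/orP; right.
  have jn : (j.+2 <= n.+1)%N by rewrite !ltnS.
  apply: le_trans (seq_form_bounded LC _) _.
    rewrite size_cat/= size_cat !size_nseq ss -!addSn subnKC//.
    by rewrite -mkE subnKC// ltnW.
  rewrite big_cat/= !big_cons big_cat/= !big_nseq !iter_mulr_1 -mulrA ler_wpM2l//.
  rewrite [leRHS]mulrC -[leRHS]mul1r; apply: ler_pM => //; first exact: prodr_ge0.
  rewrite mulrA -expr2 ler_wpM2l ?exprn_ge0// ler_piMl ?exprn_ge0//.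
  by rewrite exprn_ile1.
apply: le_trans TD _; rewrite expr2 mulrA ler_wpM2r//.
have D1 : 0 < D + 1 by rewrite ltr_wpDl.
have hD : `|h| <= e / (D + 1).
  by near: h; apply: nbhs0_le; rewrite divr_gt0// ltr_wpDl.
apply: le_trans (ler_wpM2l D0 hD) _.
by rewrite mulrCA -[leRHS]mulr1 ler_pM2l// ler_pdivrMr// mul1r lerDl.
Unshelve. all: by end_near. Qed.

(** [get] selects some derivative because one exists, and uniqueness identifies it with the explicit
    form. *)
Lemma frechet_derivative_diagonal k x : (k <= m)%N ->
  frechet_derivative (Defs.diagonal L) k x = derivative_form L (k := k) x.
Proof.
elim: k x => [|k ih] x km.
  apply/funext => v; rewrite /derivative_form enum_ord0/= ffactn0 mul1r subn0.
  by rewrite /Defs.diagonal /seq_form; congr L; apply/funext => i; rewrite nth_nseq ltn_ord.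
have E : frechet_derivative (Defs.diagonal L) k = derivative_form L (k := k).
  by apply/funext => y; apply: ih; exact: ltnW.
have dx := is_frechet_derivative_form x km.
rewrite /= E; apply: (frechet_derivative_unique _ dx).
exact: (getI dx).
Qed.

Lemma hat_derivative_diagonal k x y : (k <= m)%N ->
  hat_derivative (Defs.diagonal L) k x y =
  (m ^_ k)%:R * seq_form L (nseq k y ++ nseq (m - k) x).
Proof.
move=> km; rewrite /hat_derivative /Defs.diagonal frechet_derivative_diagonal//.
rewrite /derivative_form; congr (_ * seq_form L (_ ++ _)).
by apply: (@eq_from_nth _ 0); rewrite ?size_nseq size_map size_enum_ord// => i ik;
  rewrite nth_nseq ik (nth_map (Ordinal ik)) ?size_enum_ord.
Qed.

Lemma diagonal_combination x y (z : K) :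
  Defs.diagonal L (x + z *: y) =
  \sum_(j < m.+1) z ^+ j * (seq_form L (nseq j y ++ nseq (m - j) x) *+ 'C(m, j)).
Proof.
have [mL _] := cL.
have -> : Defs.diagonal L (x + z *: y) = seq_form L ([::] ++ nseq m (x + z *: y)).
  by rewrite /Defs.diagonal /seq_form; congr L; apply/funext => i; rewrite nth_nseq ltn_ord.
rewrite seq_form_binomial//; apply: eq_bigr => -[j jm] _ /=.
by rewrite seq_form_scale// ?size_nseq ?subnKC// mulrnAr.
Qed.

Lemma diagonal_scale (z : K) y : Defs.diagonal L (z *: y) = z ^+ m * Defs.diagonal L y.
Proof.
by rewrite /Defs.diagonal (multilinear_prod (fun=> z)) ?prodr_const ?card_ord; case: cL.
Qed.

End frechet.

(** * Coefficient estimates *)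

Section coefficients.
Context {K : numClosedFieldType}.

(** The order of a 2^e-th root of -1 divides 2^(e+1), so it is a power of 2; an order at most 2^e
    would give z^(2^e) = 1. *)
Lemma two_power_root e : exists2 z : K, z ^+ (2 ^ e) = -1 &
  forall d, (z ^+ d == 1) = (2 ^ e.+1 %| d)%N.
Proof.
pose z : K := (2 ^ e)%N.-root (-1).
have ze : z ^+ (2 ^ e) = -1 by rewrite rootCK ?expn_gt0.
exists z => //.
have z1 : z ^+ (2 ^ e.+1) = 1 by rewrite expnSr exprM ze sqrrN expr1n.
have [n zn] := prim_order_exists (expn_gt0 2 e.+1) z1.
move=> /(dvdn_pfactor _ _ (isT : prime 2))[f fe nE].
suff -> : (2 ^ e.+1 = n)%N by move=> d; rewrite -(prim_order_dvd zn).
rewrite nE; congr (2 ^ _)%N; apply/eqP; rewrite eqn_leq fe leqNgt andbT.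
apply/negP; rewrite ltnS => fle; have : z ^+ (2 ^ e) == 1.
  by rewrite -(prim_order_dvd zn) nE dvdn_exp2l.
by rewrite ze eq_sym -addr_eq0 (pnatr_eq0 _ 2).
Qed.

(* The k-th coefficient is the mean of [f (z ^+ j) / z ^+ (j * k)] over the
   powers of a primitive N-th root of unity z with N > m; N is a power of 2 so
   that these powers come in pairs of opposites. *)
Lemma coefficient_le (m : nat) (c : nat -> K) (B : K) :
  let f z := \sum_(j < m.+1) z ^+ j * c j in
  (forall z, `|z| = 1 -> `|f z| + `|f (- z)| <= 2 * B) ->
  forall k, (k <= m)%N -> `|c k| <= B.
Proof.
move=> f fB k km; have [z ze zP] := two_power_root m.
pose M := (2 ^ m)%N; pose N := (M + M)%N.
have NE : N = (2 ^ m.+1)%N by rewrite expnS mul2n -addnn.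
have mM : (m < M)%N by rewrite ltn_expl.
have M0 : (0 < M)%N by rewrite expn_gt0.
have kN : (k <= N)%N by rewrite (leq_trans km)// (leq_trans (ltnW mM))// leq_addr.
have N0 : (0 : K) < N%:R by rewrite ltr0n addn_gt0 M0.
have zN : z ^+ N = 1 by apply/eqP; rewrite zP NE.
have nz : `|z| = 1.
  apply/eqP; rewrite -(@pexpr_eq1 _ _ N) ?addn_gt0 ?M0//.
  by rewrite -normrX zN normr1.
(* As z^N = 1, the power N - k replaces the exponent -k. *)
have cE : N%:R * c k = \sum_(j < N) (z ^+ j) ^+ (N - k) * f (z ^+ j).
  under [RHS]eq_bigr do rewrite mulr_sumr.
  rewrite exchange_big/= (bigD1 (Ordinal (km : (k < m.+1)%N)))//=.
  rewrite [X in _ = _ + X]big1 ?addr0 => [|i ik].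
    rewrite (eq_bigr (fun=> c k)) ?sumr_const ?card_ord ?mulr_natl// => j _.
    by rewrite mulrA -exprD subnK// -exprM mulnC exprM zN expr1n mul1r.
  pose w := z ^+ (N - k + i).
  rewrite (eq_bigr (fun j : 'I_N => w ^+ j * c i)); last first.
    by move=> j _; rewrite mulrA -exprD /w -!exprM mulnC.
  rewrite -mulr_suml; apply/eqP; rewrite mulf_eq0; apply/orP; left.
  (* N - k + i lies strictly between 0 and 2 N, so N divides it only if i = k. *)
  have w1 : w != 1.
    rewrite /w zP -NE; apply: contra ik => /dvdnP[q qE].
    apply/eqP/val_inj => /=; have im : (i <= m)%N by rewrite -ltnS.
    have {}mM : (m < N)%N by rewrite ltn_addr.
    by case: q qE => [|[|q]]; rewrite ?mulSn; lia.
  have : (w - 1) * (\sum_(j < N) w ^+ j) = 0.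
    by rewrite -subrX1 /w -exprM mulnC exprM zN expr1n subrr.
  by move/eqP; rewrite mulf_eq0 subr_eq0 (negbTE w1).
rewrite -(ler_pM2l N0) -[X in X * `|_|]ger0_norm ?ler0n// -normrM cE.
apply: le_trans (ler_norm_sum _ _ _) _.
under eq_bigr do rewrite normrM !normrX nz !expr1n mul1r.
(* The second half of the powers are the opposites of the first, as z^M = -1. *)
rewrite big_split_ord/= -big_split/=.
apply: (@le_trans _ _ (\sum_(j < M) 2 * B)).
  apply: ler_sum => j _.
  by rewrite exprD ze mulN1r; apply: fB; rewrite normrX nz expr1n.
by rewrite sumr_const card_ord -[_ *+ M]mulr_natl mulrA -natrM muln2 -addnn.
Qed.

End coefficients.

(** * From a two-point inequality to the derivative bound *)

Section poly_norm_bound.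
Context {R : realType} {X : normedModType R[i]}.

Lemma rnorm_le (V : normedZmodType R[i]) (v : V) (r : R) :
  (`|v| <= r%:C%C) = (rnorm v <= r).
Proof. by rewrite rnormE lecR. Qed.

Lemma poly_norm_homogeneous (P : X -> R[i]) (m : nat) (M : R) :
  (forall z y, P (z *: y) = z ^+ m * P y) -> poly_norm P = M%:E ->
  forall y, `|P y| <= M%:C%C * `|y| ^+ m.
Proof.
move=> homP PM y.
have H u : `|u| <= 1 -> `|P u| <= M%:C%C.
  rewrite -[1]/(1%:C%C) !rnorm_le => u1.
  by rewrite -lee_fin -PM; apply: ereal_sup_ubound; exists u.
have [->|y0] := eqVneq y 0.
  (* At y = 0 the right-hand side is M if m = 0, since 0^0 = 1; otherwise both sides vanish. *)
  have := homP 0 0; rewrite scale0r normr0.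
  case: m homP => [|m] homP.
    by rewrite expr0 mulr1 => _; apply: H; rewrite normr0 ler01.
  by rewrite !expr0n/= mul0r mulr0 => ->; rewrite normr0.
have ny : 0 < `|y| by rewrite normr_gt0.
rewrite -ler_pdivrMr ?exprn_gt0//.
have := H (`|y|^-1 *: y) (normalize_le1 y).
by rewrite homP normrM normrX normfV normr_id exprVn mulrC.
Qed.

(** The geometry of X enters only through the two-point inequality, used at u = x and v = z r y with
    |z| = 1. It bounds the k-th coefficient of P (x + z r y) in z, which is r^k / k! times the
    derivative. *)
Lemma poly_norm_hat_derivative (m : nat) (P : X -> R[i]) (k : nat) (s : R) (x : X) :
  continuous_homogeneous_polynomial m P -> (k <= m)%N -> 1 <= s -> rnorm x < 1 ->
  (forall u v : X, rnorm u `^ s + rnorm v `^ s <= 1 ->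
    rnorm (u + v) ^+ m + rnorm (u - v) ^+ m <= 2) ->
  (poly_norm (hat_derivative P k x) <=
    (k`!%:R / (1 - rnorm x `^ s) `^ (k%:R / s))%:E * poly_norm P)%E.
Proof.
move=> [L [cL sL ->]] km s1 x1 cot; have [mL _] := cL.
have s0 : 0 < s by rewrite (lt_le_trans _ s1).
set P' := Defs.diagonal L.
have xs1 : rnorm x `^ s < 1.
  apply: (@lt_le_trans _ _ (1 `^ s)); last by rewrite powR1.
  by rewrite gt0_ltr_powR// nnegrE ?rnorm_ge0.
pose r := (1 - rnorm x `^ s) `^ s^-1.
have r0 : 0 < r by rewrite powR_gt0 ?subr_gt0.
have rs : r `^ s = 1 - rnorm x `^ s.
  by rewrite -powRrM mulVf ?gt_eqF// powRr1// subr_ge0 ltW.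
have -> : (1 - rnorm x `^ s) `^ (k%:R / s) = r ^+ k.
  by rewrite -powR_mulrn ?ltW// -powRrM mulrC.
have b0 : 0 < k`!%:R / r ^+ k by rewrite divr_gt0 ?exprn_gt0// ltr0n fact_gt0.
have P0 : (0 <= poly_norm P')%E.
  apply: le_trans (_ : (rnorm (P' 0 : R[i]^o))%:E <= _)%E.
    by rewrite lee_fin rnorm_ge0.
  by apply: ereal_sup_ubound; exists 0 => //=; rewrite rnorm0.
(* If the norm of the polynomial is infinite, so is the right-hand side, its constant being
   positive. *)
case PM : (poly_norm P') P0 => [M| |]//; last by rewrite gt0_muley ?leey ?lte_fin.
rewrite lee_fin => M0.
have PE := poly_norm_homogeneous (diagonal_scale cL) PM.
apply: ge_ereal_sup => _ [y /= y1 <-]; rewrite -EFinM lee_fin.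
rewrite hat_derivative_diagonal//.
pose c j := seq_form L (nseq j (r%:C%C *: y) ++ nseq (m - j) x) *+ 'C(m, j).
have cE j : (j <= m)%N -> c j =
    r%:C%C ^+ j * (seq_form L (nseq j y ++ nseq (m - j) x) *+ 'C(m, j)).
  by move=> jm; rewrite /c seq_form_scale// ?size_nseq ?subnKC// mulrnAr.
have cM : `|c k| <= M%:C%C.
  apply: (@coefficient_le _ m) => // z z1.
  rewrite -!diagonal_combination// scaleNr.
  apply: le_trans (lerD (PE _) (PE _)) _.
  rewrite -mulrDr [leRHS]mulrC ler_wpM2l ?ler0c//.
  rewrite !rnormE -!rmorphXn -rmorphD -(rmorph_nat (real_complex R)) lecR.
  apply: cot; rewrite -lerBrDl -rs.
  apply: ge0_ler_powR; rewrite ?nnegrE ?rnorm_ge0 ?(ltW r0) ?(ltW s0)//.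
  rewrite -rnorm_le !normrZ z1 mul1r ger0_norm ?ler0c ?(ltW r0)// rnormE -rmorphM lecR.
  by rewrite -[leRHS]mulr1 ler_pM2l.
rewrite -rnorm_le.
have -> : (m ^_ k)%:R * seq_form L (nseq k y ++ nseq (m - k) x) =
    (k`!%:R / r ^+ k)%:C%C * c k.
  rewrite cE// mulrA -rmorphXn -rmorphM divfK ?expf_neq0 ?gt_eqF//.
  by rewrite rmorph_nat -bin_ffact natrM mulrAC mulrC mulrA -mulr_natl; ring.
rewrite normrM; set b := _ / _ in b0 *.
rewrite (rmorphM _ b) ger0_norm ?ler0c ?(ltW b0)//.
by rewrite ler_wpM2l ?ler0c ?(ltW b0).
Qed.

End poly_norm_bound.

(** * The spaces L_p *)

Local Open Scope quotient_scope.

(** On representatives the norm is the integral norm of the modulus, and [clarkson] holds at every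
    point. *)
Lemma Lp_clarkson (R : realType) d (T : measurableType d)
    (mu : {measure set T -> \bar R}) (r : R) (p1 : (1 <= r%:E)%E) (q s : R)
    (u v : Lp mu p1) :
  2 <= q -> s^-1 + q^-1 = 1 -> s <= r <= q ->
  rnorm (u + v) `^ q + rnorm (u - v) `^ q <=
  2 * (rnorm u `^ s + rnorm v `^ s) `^ (q - 1).
Proof.
move=> q2 sq srq.
have NE (f : cLfunType mu p1) :
    ('N[mu]_(r%:E)[EFin \o (fun t => rnorm (val f t))] =
    (rnorm (\pi_(Lp mu p1) f))%:E)%E.
  have [_ fy] := cLfunP _ _ _ (valP f).
  rewrite -[rnorm _]/(complex.Re (Lp_norm (\pi_(Lp mu p1) f))) Lp_norm_pi/= fineK//.
  by rewrite ge0_fin_numE//; exact: Lnorm_ge0.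
have mE (f : cLfunType mu p1) : measurable_fun [set: T] (fun t => rnorm (val f t)).
  by have [mf _] := cLfunP _ _ _ (valP f); exact: cmeasurable_rnorm.
have uB : u - v = \pi_(Lp mu p1) (repr u - repr v).
  rewrite -scaleN1r -[in LHS](reprK u) -[in LHS](reprK v).
  by rewrite [_ *: _]Defs.pi_scale -Defs.pi_add scaleN1r.
have uD : u + v = \pi_(Lp mu p1) (repr u + repr v).
  by rewrite Defs.pi_add !reprK.
rewrite uB uD -{3}(reprK u) -{3}(reprK v).
apply: (Lnorm_clarkson q2 sq srq (mE _) (mE _) (mE _) (mE _) _ _ _ _
  (NE _) (NE _) (NE _) (NE _)) => t; try exact: rnorm_ge0.
exact: clarkson.
Qed.

Local Close Scope quotient_scope.

Section Lp_bounds.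
Context {R : realType} {d} {T : measurableType d} {mu : {measure set T -> \bar R}}.
Context {p : \bar R} {p1 : (1 <= p)%E} {m : nat} {P : Lp mu p1 -> R[i]}.
Context (hP : continuous_homogeneous_polynomial m P).
Context {k : nat} (km : (k <= m)%N) {x : Lp mu p1} (x1 : rnorm x < 1).

(** For s = 1, both norms in the two-point inequality are at most ||u|| + ||v|| <= 1. *)
Lemma poly_norm_hat_derivative1 :
  (poly_norm (hat_derivative P k x) <=
    (k`!%:R / (1 - rnorm x `^ 1) `^ (k%:R / 1))%:E * poly_norm P)%E.
Proof.
apply: (poly_norm_hat_derivative hP) => // u v.
rewrite !powRr1 ?rnorm_ge0// => uv1.
have H (w : Lp mu p1) : rnorm w <= rnorm u + rnorm v -> rnorm w ^+ m <= 1.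
  by move=> /le_trans/(_ uv1) w1; rewrite exprn_ile1// rnorm_ge0.
have := lerD (H (u + v) (rnormD _ _)) (H (u - v) _); apply.
by apply: le_trans (rnormD _ _) _; rewrite /rnorm normrN.
Qed.

(** When ||u||^s + ||v||^s <= 1, Clarkson's inequality bounds the sum of q-th powers by 2, and
    [powR_sum_le2] lowers q to m. *)
Lemma poly_norm_hat_derivative_conj (q s : R) : p \is a fin_num ->
  2 <= q -> s^-1 + q^-1 = 1 -> s <= fine p <= q -> m%:R <= q -> (0 < m)%N ->
  (poly_norm (hat_derivative P k x) <=
    (k`!%:R / (1 - rnorm x `^ s) `^ (k%:R / s))%:E * poly_norm P)%E.
Proof.
move: p1 P hP x x1; case: p => // r r1 P' hP' x' x'1 _ q2 sq srq mq m0.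
have q1 : 1 < q by rewrite (lt_le_trans _ q2)// ltr1n.
have s1 : 1 <= s by exact: conjugate_exp_ge1 sq.
apply: (poly_norm_hat_derivative hP') => // u v uv1.
apply: (powR_sum_le2 m0 mq); rewrite ?rnorm_ge0//.
apply: le_trans (Lp_clarkson u v q2 sq srq) _.
rewrite ler_piMr//; apply: (@le_trans _ _ (1 `^ (q - 1))); last by rewrite powR1.
have q10 : 0 <= q - 1 by rewrite subr_ge0 ltW.
by apply: ge0_ler_powR; rewrite ?nnegrE// addr_ge0// powR_ge0.
Qed.

End Lp_bounds.

Lemma hoelder_conjugate_EFin (R : realType) (r : R) : 1 < r ->
  hoelder_conjugate r%:E = (r / (r - 1))%:E.
Proof.
move=> r1; rewrite /hoelder_conjugate/= eqe gt_eqF ?(lt_trans ltr01)//.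
by rewrite -EFinD inver subr_eq0 gt_eqF.
Qed.

Theorem theorem7 (R : realType) (d : measure_display) (T : measurableType d)
    (mu : {measure set T -> \bar R}) (p : \bar R) (p1 : (1 <= p)%E)
    (m : nat) (hm : (2 <= m)%N)
    (P : Lp mu p1 -> R[i]) (hP : continuous_homogeneous_polynomial m P)
    (k : nat) (hk : (1 <= k <= m)%N)
    (x : Lp mu p1) (hx : rnorm x < 1) :
  let m' : \bar R := hoelder_conjugate m%:R%:E in
  let p' : \bar R := hoelder_conjugate p in
  let bound (s : R) : \bar R :=
    (k`!%:R / (1 - rnorm x `^ s) `^ (k%:R / s))%:E in
  [/\ (p <= m')%E ->
        (poly_norm (hat_derivative P k x) <= bound (fine p) * poly_norm P)%E,
      (m' <= p <= m%:R%:E)%E ->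
        (poly_norm (hat_derivative P k x) <= bound (fine m') * poly_norm P)%E
    & (m%:R%:E <= p)%E ->
        (poly_norm (hat_derivative P k x) <= bound (fine p') * poly_norm P)%E].
Proof.
move=> m' p' bound.
have /andP[_ km] := hk.
have m0 : (0 < m)%N by rewrite ltnW.
have m2 : 2 <= m%:R :> R by rewrite ler_nat.
have gt1 (r : R) : 2 <= r -> 1 < r by apply: lt_le_trans; rewrite ltr1n.
have m'E : m' = (m%:R / (m%:R - 1))%:E.
  by apply: hoelder_conjugate_EFin; exact: gt1.
have fin (r : R) : (p <= r%:E)%E -> p \is a fin_num.
  move=> pr; rewrite fin_numE gt_eqF ?(lt_le_trans _ p1) ?ltNyr//.
  by rewrite lt_eqF// (le_lt_trans pr) ?ltry.
rewrite m'E /p' /=; split=> [pm|/andP[mp pm]|mp].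
(* Here p <= m' <= 2 <= m <= p', so s = p and q = p' work; p = 1, where p' is infinite, is left to
   the triangle inequality. *)
- have pf := fin _ pm.
  have {}pm : fine p <= m%:R / (m%:R - 1) by rewrite -lee_fin fineK.
  have : 1 <= fine p by rewrite -lee_fin fineK.
  rewrite le_eqVlt => /predU1P[pE|p_gt1].
    by rewrite /bound -pE; exact: (poly_norm_hat_derivative1 hP km hx).
  have mq := le_conjugate_exp (gt1 _ m2) p_gt1 pm.
  have q2 := le_trans m2 mq.
  apply: (poly_norm_hat_derivative_conj hP km hx pf q2) => //.
    by rewrite addrC; exact: conjugate_expE p_gt1.
  by rewrite lexx (le_trans pm)// (le_trans (conjugate_exp_le2 m2)).
(* The exponents are s = m' and q = m. *)
- have pf := fin _ pm.
  apply: (poly_norm_hat_derivative_conj hP km hx pf m2) => //.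
    exact: conjugate_expE (gt1 _ m2).
  by rewrite -!lee_fin fineK// mp pm.
(* For finite p, s = p' <= 2 <= m <= p = q; for p infinite, p' = 1 and the triangle inequality
   suffices. *)
- have [py|pNy] := eqVneq p +oo%E.
    rewrite (_ : hoelder_conjugate p = 1%E) ?py//.
    exact: (poly_norm_hat_derivative1 hP km hx).
  have pf : p \is a fin_num.
    by rewrite fin_numE pNy gt_eqF ?(lt_le_trans _ p1) ?ltNyr.
  have mr : m%:R <= fine p by rewrite -lee_fin fineK.
  have r2 := le_trans m2 mr.
  rewrite (_ : hoelder_conjugate p = (fine p / (fine p - 1))%:E); last first.
    by rewrite -[in LHS](fineK pf) hoelder_conjugate_EFin// gt1.
  apply: (poly_norm_hat_derivative_conj hP km hx pf r2) => //.
    exact: conjugate_expE (gt1 _ r2).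
  by rewrite lexx andbT (le_trans (conjugate_exp_le2 r2)).
Qed.
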